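(* Let $\varepsilon>0$, $0\le t_n<t_{n+1}\le T$ and $\Delta t_n:=t_{n+1}-t_n$. Let $d(t)$ be the signed distance at time $t$ between the vehicle and the set of obstacles and let $\overline{v}$ be the maximum relative velocity between the vehicle and the obstacles. Suppose that $$\min\big(d(t_n),d(t_{n+1})\big)>\varepsilon .$$ Then $$\frac{\Delta t_n}{2}<\frac{\varepsilon}{\overline{v}}\quad\Longrightarrow\quad d(t)>0\ \text{ for all } t\in[t_n,t_{n+1}].$$
   Context: For $\psi\in\mathbb{R}$ let $R_\psi=\begin{pmatrix}\cos\psi&-\sin\psi\\ \sin\psi&\cos\psi\end{pmatrix}$, and for $j=1,\dots,4$ let $T_j=\begin{pmatrix}(-1)^{j-1}&0\\0&(-1)^{\lfloor (j-1)/2\rfloor}\end{pmatrix}$. Vehicle: fix half-lengths $\ell=(\ell_x,\ell_y)^T$ with $\ell_x,\ell_y>0$. For $z=(x,y,\psi,v)\in\mathbb{R}^4$, with $X=(x,y)^T$, the vehicle is the closed rectangle $\mathcal{V}(z)=X+R_\psi([-\ell_x,\ell_x]\times[-\ell_y,\ell_y])$, with corners $X_j(z)=X+R_\psi T_j\ell$, $1\le j\le4$. Let $T>0$. The vehicle trajectory $z=(x,y,\psi,v):[0,T]\to\mathbb{R}^4$ is an absolutely continuous solution of the point mass model $x'=v\cos\psi$, $y'=v\sin\psi$, $\psi'=w$, $v'=a$ (a.e. on $[0,T]$), with measurable controls $a(t)\in[a_{min},a_{max}]$, $|w(t)|\le w_{max}$. Obstacles: let $k\ge1$. For $1\le i\le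 k$, obstacle $i$ has half-lengths $\ell^i=(\ell^i_x,\ell^i_y)^T$ with positive entries, center $X^i(s)\in\mathbb{R}^2$ and orientation $\psi_i(s)\in\mathbb{R}$, where $X^i,\psi_i$ are Lipschitz continuous on $[0,T]$. It is the closed rectangle $\mathcal{O}_i(s)=X^i(s)+R_{\psi_i(s)}([-\ell^i_x,\ell^i_x]\times[-\ell^i_y,\ell^i_y])$, with corners $X^i_j(s)=X^i(s)+R_{\psi_i(s)}T_j\ell^i$, $1\le j\le4$. The number $\overline{v}$ is an upper bound for all relative velocities between vehicle corners and obstacle corners: writing $X_j(s)=X_j(z(s))$, $\|\dot X_j(s)-\dot X^i_{j'}(s)\|\le\overline{v}$ for all $1\le j,j'\le4$, $1\le i\le k$ and (almost) all $s\in[0,T]$, with $\|\cdot\|$ the Euclidean norm; by convention $\varepsilon/\overline{v}=+\infty$ if $\overline{v}=0$. Signed distances: for a nonempty compact set $B\subset\mathbb{R}^2$ the signed distance to $B$ is $d_B(x)=\mathrm{dist}(x,B)$ if $x\notin B$ and $d_B(x)=-\mathrm{dist}(x,\mathbb{R}^2\setminus B)$ if $x\in B$. For nonempty compact $A,B\subset\mathbb{R}^2$ let $\mu(A,B):=\min_{x\in A}d_B(x)$ and $d(A,B):=\min(\mu(A,B),\mu(B,A))$. Finally $d(t):=d\big(\mathcal{V}(z(t)),\bigcup_{1\le i\le k}\mathcal{O}_i(t)\big)$; $d(t)>0$ means there is no collision at time $t$. *)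

(* Defs.v *)
From HB Require Import structures.
From mathcomp Require Import all_boot all_order all_algebra.
From mathcomp Require Import all_classical all_reals all_analysis.
Import Order.TTheory GRing.Theory Num.Theory.
Import numFieldNormedType.Exports.

Set Implicit Arguments.
Unset Strict Implicit.
Unset Printing Implicit Defensive.

Local Open Scope classical_set_scope.
Local Open Scope ring_scope.

(* The library norm on 'cV[R]_2 is the max norm, hence this definition. *)
Definition enorm (R : realType) (u : 'cV[R]_2) : R :=
  Num.sqrt (\sum_i u i 0 ^+ 2).

Definition vec2 (R : realType) (a b : R) : 'cV[R]_2 :=
  \col_(i < 2) if i == 0 then a else b.

Definition rot (R : realType) (psi : R) : 'M[R]_2 :=
  \matrix_(i < 2, j < 2)
    if i == j then cos psi else if i == 0 then - sin psi else sin psi.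

(* The four corners are numbered from 0, so that j stands for the usual j - 1. *)
Definition corner_sign (R : realType) (j : 'I_4) : 'M[R]_2 :=
  diag_mx (\row_(i < 2) if i == 0 then (-1) ^+ j else (-1) ^+ j./2).

Definition corner (R : realType) (X : 'cV[R]_2) (psi : R) (l : 'cV[R]_2)
    (j : 'I_4) : 'cV[R]_2 :=
  X + rot psi *m (corner_sign R j *m l).

Definition rectangle (R : realType) (X : 'cV[R]_2) (psi : R) (l : 'cV[R]_2) :
    set 'cV[R]_2 :=
  [set X + rot psi *m u |
     u in [set u : 'cV[R]_2 | forall i, - l i 0 <= u i 0 <= l i 0]].

Record state (R : realType) := State {
  xpos : R;
  ypos : R;
  heading : R;
  speed : R
}.

Definition position (R : realType) (z : state R) : 'cV[R]_2 :=
  vec2 (xpos z) (ypos z).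

Definition vehicle (R : realType) (l : 'cV[R]_2) (z : state R) :
    set 'cV[R]_2 :=
  rectangle (position z) (heading z) l.

Definition vehicle_corner (R : realType) (l : 'cV[R]_2) (z : state R)
    (j : 'I_4) : 'cV[R]_2 :=
  corner (position z) (heading z) l j.

Definition absolutely_continuous (R : realType) (a b : R) (f : R -> R) : Prop :=
  forall e : R, 0 < e -> exists2 d : R, 0 < d &
    forall (n : nat) (u v : 'I_n -> R),
      (forall i, [/\ a <= u i, u i <= v i & v i <= b]) ->
      trivIset setT (fun i => `]u i, v i[%classic) ->
      \sum_(i < n) (v i - u i) < d ->
      \sum_(i < n) `|f (v i) - f (u i)| < e.

(* Measurability for the Lebesgue sigma-algebra (the canonical sigma-algebra
   on R is only the Borel one). *)
Definition lebesgue_measurable_fun (R : realType) (D : set R) (f : R -> R) :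
    Prop :=
  measurable_fun (D : set (caratheodory_type ((@wlength R idfun)^*)%mu)) f.

Record point_mass_trajectory (R : realType) (T amin amax wmax : R)
    (z : R -> state R) (w a : R -> R) : Prop := PointMassTrajectory {
  traj_ac_x : absolutely_continuous 0 T (fun t => xpos (z t));
  traj_ac_y : absolutely_continuous 0 T (fun t => ypos (z t));
  traj_ac_psi : absolutely_continuous 0 T (fun t => heading (z t));
  traj_ac_v : absolutely_continuous 0 T (fun t => speed (z t));
  traj_w_meas : lebesgue_measurable_fun `[0, T] w;
  traj_a_meas : lebesgue_measurable_fun `[0, T] a;
  traj_w_bound : forall t, 0 <= t <= T -> `|w t| <= wmax;
  traj_a_bound : forall t, 0 <= t <= T -> amin <= a t <= amax;
  traj_ode : {ae (@lebesgue_measure R), forall t, 0 <= t <= T ->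
    [/\ is_derive t 1 (fun s => xpos (z s)) (speed (z t) * cos (heading (z t))),
        is_derive t 1 (fun s => ypos (z s)) (speed (z t) * sin (heading (z t))),
        is_derive t 1 (fun s => heading (z s)) (w t) &
        is_derive t 1 (fun s => speed (z s)) (a t)]}
}.

Definition dist_to (R : realType) (x : 'cV[R]_2) (B : set 'cV[R]_2) : R :=
  inf [set enorm (x - y) | y in B].

Definition signed_dist (R : realType) (B : set 'cV[R]_2) (x : 'cV[R]_2) : R :=
  if x \in B then - dist_to x (~` B) else dist_to x B.

(* For nonempty compact A and B the infimum is attained, signed_dist B being
   1-Lipschitz. *)
Definition min_signed_dist (R : realType) (A B : set 'cV[R]_2) : R :=
  inf [set signed_dist B x | x in A].

Definition set_signed_dist (R : realType) (A B : set 'cV[R]_2) : R :=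
  Num.min (min_signed_dist A B) (min_signed_dist B A).

Section Obstacles.
Variables (R : realType) (k : nat).
Variables (lo : 'I_k -> 'cV[R]_2) (Xo : 'I_k -> R -> 'cV[R]_2).
Variable psio : 'I_k -> R -> R.

Definition obstacle (i : 'I_k) (t : R) : set 'cV[R]_2 :=
  rectangle (Xo i t) (psio i t) (lo i).

Definition obstacle_corner (i : 'I_k) (j : 'I_4) (t : R) : 'cV[R]_2 :=
  corner (Xo i t) (psio i t) (lo i) j.

Definition vehicle_obstacles_dist (l : 'cV[R]_2) (z : R -> state R) (t : R) :
    R :=
  set_signed_dist (vehicle l (z t)) (\bigcup_(i in [set: 'I_k]) obstacle i t).

(* The corners are absolutely continuous on [0, T], hence derivable at almost
   every point, so that the default value of derive1 is irrelevant here. *)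
Definition relative_velocity_bound (T : R) (l : 'cV[R]_2) (z : R -> state R)
    (vbar : R) : Prop :=
  {ae (@lebesgue_measure R), forall s, 0 <= s <= T ->
    forall (i : 'I_k) (j j' : 'I_4),
      enorm (derive1 (fun r => vehicle_corner l (z r) j) s
             - derive1 (obstacle_corner i j') s) <= vbar}.

End Obstacles.

(* Main.v *)
Require Import Defs.
From mathcomp Require Import all_boot all_order all_algebra.
From mathcomp Require Import all_classical all_reals all_analysis.
From mathcomp Require Import ring lra.
From HB Require Import structures.
Import Order.TTheory GRing.Theory Num.Theory.
Import numFieldNormedType.Exports.
Local Open Scope classical_set_scope.
Local Open Scope ring_scope.

(** A point of the vehicle and a point of an obstacle, with fixed coordinates in
the moving frames, are fixed convex combinations of the corners. Their
difference is therefore a convex combination of differences of corners, whose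
a.e. derivative is bounded by [vbar], and it moves by at most [vbar * |t - t'|]
between [t] and [t']. If [d t <= 0] there are such points at time [t] at
arbitrarily small distance; transported to the endpoint [t'] nearest to [t] they
contradict [d t' > eps].

Obstacle corners are merely Lipschitz, so their a.e. differentiability has to be
established: after rescaling, a Lipschitz function is, up to a linear term, a
nondecreasing function whose Stieltjes measure is dominated by the Lebesgue
measure, and Radon-Nikodym and Lebesgue differentiation apply. *)

(** * Almost everywhere differentiability of Lipschitz functions *)

(** All slopes lie in [0, 1], so [F] and [id - F] are both nondecreasing and continuous, and each
    generates a Stieltjes measure. *)
Definition increment01 {R : realType} (F : R -> R) :=
  forall x y, x <= y -> 0 <= F y - F x <= y - x.

Lemma increment01_continuous {R : realType} (F : R -> R) :
  increment01 F -> continuous F.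
Proof.
move=> F01 x; apply/cvgrPdist_le => e e0; near=> y.
apply: (@le_trans _ _ `|x - y|); last first.
  by near: y; apply: cvgr_dist_le => //; exact: cvg_id.
have [/F01/andP[a b]|/ltW/F01/andP[a b]] := leP x y.
  by rewrite (distrC x) (distrC (F x)) !ger0_norm//; apply: le_trans b.
by rewrite !ger0_norm//; apply: le_trans b.
Unshelve. all: by end_near. Qed.

Lemma increment01_nondecreasing {R : realType} (F : R -> R) :
  increment01 F -> nondecreasing F.
Proof. by move=> F01 x y /F01/andP[]; rewrite subr_ge0. Qed.

Definition increment01_cumulative {R : realType} {F : R -> R}
    (F01 : increment01 F) : cumulative R R :=
  HB.pack F (isCumulative.Build R _ R F
    (increment01_nondecreasing F F01)
    (right_continuousW (increment01_continuous F F01))).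

Lemma lebesgue_aeS {R : realType} (P Q : R -> Prop) : (forall x, P x -> Q x) ->
  {ae (@lebesgue_measure R), forall x, P x} ->
  {ae (@lebesgue_measure R), forall x, Q x}.
Proof. by move=> PQ; apply: filterS PQ; exact: (ae_filter_ringOfSetsType (@lebesgue_measure R)). Qed.

Lemma lebesgue_aeI {R : realType} (P Q : R -> Prop) :
  {ae (@lebesgue_measure R), forall x, P x} ->
  {ae (@lebesgue_measure R), forall x, Q x} ->
  {ae (@lebesgue_measure R), forall x, P x /\ Q x}.
Proof. by apply: filterI; exact: (ae_filter_ringOfSetsType (@lebesgue_measure R)). Qed.

Lemma lebesgue_stieltjes_measure_itvoc {R : realType} (f : cumulative R R) (a b : R) :
  a <= b -> lebesgue_stieltjes_measure f `]a, b]%classic = (f b - f a)%:E.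
Proof.
move=> ab; rewrite /lebesgue_stieltjes_measure/= /measure_extension/=.
rewrite measurable_mu_extE/=; first by rewrite wlength_itv_bnd.
exact: is_ocitv.
Qed.

(* F and id - F are both cumulative, and their measures add up to the Lebesgue
   measure. *)
Lemma lebesgue_stieltjes_le_lebesgue {R : realType} {F : R -> R}
    (F01 : increment01 F) (A : set (measurableTypeR R)) : measurable A ->
  (lebesgue_stieltjes_measure (increment01_cumulative F01) A
    <= lebesgue_measure A)%E.
Proof.
move=> mA.
have G01 : increment01 (fun x => x - F x).
  by move=> x y /F01 /andP[] ? ?; apply/andP; split; lra.
pose m1 := lebesgue_stieltjes_measure (increment01_cumulative F01).
pose m2 := lebesgue_stieltjes_measure (increment01_cumulative G01).
have addE B : measure_add m1 m2 B = (m1 B + m2 B)%E.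
  by rewrite /measure_add /msum !big_ord_recl big_ord0 adde0.
rewrite (@lebesgue_measure_unique _ (measure_add m1 m2))//; last first.
  move=> _ [[a b] _ <-] /=; apply/esym; apply: (etrans (addE _)); apply/esym.
  rewrite /m1 /m2.
  have [ab|ba] := leP a b; last first.
    by rewrite set_itv_ge ?measure0 ?adde0// bnd_simp -leNgt ltW.
  rewrite lebesgue_measure_itv/= !lebesgue_stieltjes_measure_itvoc//= -EFinD.
  rewrite lte_fin; case: ltgtP ab => // [ab|->] _; last by congr EFin; lra.
  by congr EFin; lra.
rewrite [leRHS]addE.
by rewrite leeDl.
Qed.

(** On []a, b]] the Stieltjes measure of [F] is finite and absolutely continuous with respect to the
    Lebesgue measure. Its Radon-Nikodym density makes [F] an indefinite integral there, which [FTC1]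
    differentiates almost everywhere. *)
Lemma increment01_ae_derivable {R : realType} (a b : R) (F : R -> R) :
  increment01 F ->
  {ae (@lebesgue_measure R), forall x, a < x < b -> derivable F x 1}.
Proof.
move=> F01; have [ba|ab] := leP b a.
  by apply/aeW => x /andP[ax xb]; have := lt_trans ax (lt_le_trans xb ba); rewrite ltxx.
pose nu := lebesgue_stieltjes_measure (increment01_cumulative F01).
have mD : measurable (`]a, b]%classic : set (measurableTypeR R)) by [].
have nuoo : (nu `]a, b]%classic < +oo)%E.
  by rewrite /nu lebesgue_stieltjes_measure_itvoc ?ltW// ltry.
have dom : mfrestr mD nuoo `<< @lebesgue_measure R.
  move=> A A0 B mB BA; apply/eqP; rewrite eq_le measure_ge0 andbT.
  rewrite /mfrestr /mrestr.
  apply: (@le_trans _ _ (@lebesgue_measure R (B `&` `]a, b]%classic))).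
    by apply: lebesgue_stieltjes_le_lebesgue; exact: measurableI.
  rewrite -(A0 B mB BA).
  by apply: le_measure; rewrite ?inE//; exact: measurableI.
have [h [h0 hfin hint hE]] := radon_nikodym_sigma_finite dom.
pose f := fine \o h.
have fE : EFin \o f = h by apply/funext => x /=; rewrite fineK.
have intf : lebesgue_measure.-integrable setT (EFin \o f) by rewrite fE.
have locf : locally_integrable setT f.
  by apply: open_integrable_locally => //; exact: openT.
have intfy y : lebesgue_measure.-integrable [set` `]a, y]] (EFin \o f).
  exact: (integrableS measurableT).
have FE x : a <= x <= b ->
    F x = F a + \int[lebesgue_measure]_(t in `]a, x]) f t.
  move=> /andP[ax xb]; rewrite /Rintegral.
  rewrite -[X in fine X]/(\int[lebesgue_measure]_(t in `]a, x]) (EFin \o f) t)%E fE.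
  rewrite -hE// [X in fine X](_ : _ = (F x - F a)%:E); first by rewrite /= subrKC.
  rewrite -(lebesgue_stieltjes_measure_itvoc (increment01_cumulative F01))//.
  congr (nu _); apply/setIidPl => y /=; rewrite !in_itv/= => /andP[-> yx].
  exact: le_trans xb.
have := FTC1 intfy locf.
apply: lebesgue_aeS => x + /andP[ax xb].
rewrite /= lte_fin => /(_ ax) [dx _].
(* [FE] holds only on [[a, b]]; since [x] is interior, it holds near [x], and derivability is
   local. *)
apply: near_eq_derivable (derivableD (derivable_cst (F a) x 1) dx).
near=> y; apply/esym/FE; apply/andP; split; apply/ltW; near: y.
  exact: lt_nbhsr.
exact: lt_nbhsl.
Unshelve. all: by end_near. Qed.

(** If [g] has Lipschitz constant [K > 0], the slopes of [g / K] lie in [-1, 1], so those of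
    [(g / K + id) / 2] lie in [0, 1]; [g] is recovered from this function linearly. *)
Lemma klipschitz_ae_derivable {R : realType} (a b M : R) (g : R -> R) :
  (forall x y, a <= x <= b -> a <= y <= b -> `|g x - g y| <= M * `|x - y|) ->
  {ae (@lebesgue_measure R), forall x, a < x < b -> derivable g x 1}.
Proof.
move=> gM; have [ba|ab] := leP b a.
  by apply/aeW => x /andP[ax xb]; have := lt_trans ax (lt_le_trans xb ba); rewrite ltxx.
pose K := `|M| + 1.
have K0 : 0 < K by rewrite ltr_wpDl.
have gK x y : a <= x <= b -> a <= y <= b -> `|g x - g y| <= K * `|x - y|.
  move=> xab yab; apply: le_trans (gM x y xab yab) _.
  by rewrite ler_wpM2r// /K (le_trans (ler_norm M))// lerDl.
(* [increment01] is a condition on the whole line, whereas [g] is controlled on [[a, b]] only.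
   Composing with the projection onto [[a, b]] extends [g] with the same constant. *)
pose clamp x := Num.min (Num.max x a) b.
have clampE x : a <= x <= b -> clamp x = x.
  by move=> /andP[ax xb]; rewrite /clamp (max_idPl ax) (min_idPl xb).
have clampI x : a <= clamp x <= b.
  by rewrite /clamp le_min ge_min ?le_max !lexx ?orbT (ltW ab).
have clamp01 : increment01 clamp.
  move=> x y xy; rewrite /clamp.
  by case: (leP x a) => ?; case: (leP y a) => ?; case: (leP a b) => ?;
    case: (leP x b) => ?; case: (leP y b) => ?; apply/andP; split; lra.
pose F x := (g (clamp x) / K + clamp x) / 2.
have F01 : increment01 F.
  move=> x y xy; rewrite /F.
  have /andP[c0 cxy] := clamp01 x y xy.
  have := gK _ _ (clampI y) (clampI x).
  rewrite (ger0_norm c0) -ler_pdivrMl// mulrC -{1}(gtr0_norm K0) -normf_div.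
  rewrite ler_norml mulrBl => /andP[? ?]; apply/andP; split; lra.
have := increment01_ae_derivable a b F F01.
apply: lebesgue_aeS => x dF /andP[ax xb].
have {}dF : derivable (fun y => K * (2 * F y - y)) x 1.
  by apply: derivableM => //; apply: derivableB => //; apply: derivableM => //; apply: dF; rewrite ax.
apply: near_eq_derivable dF.
near=> y.
have yab : a <= y <= b.
  by apply/andP; split; apply/ltW; near: y; [exact: lt_nbhsr|exact: lt_nbhsl].
by rewrite /F clampE//; field; rewrite gt_eqF.
Unshelve. all: by end_near. Qed.

(** * Increments of absolutely continuous functions *)

(** Let [m] be the supremum of the points satisfying [P]. The step at [m] carries [P] from a point
    just left of [m] to [m] itself, then, if [m < b], to a point beyond [m], which is absurd. *)
Lemma segment_real_induction {R : realType} (a b : R) (P : R -> Prop) : a <= b -> P a ->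
  (forall x, a <= x <= b -> exists2 d, 0 < d &
     forall s t, a <= s -> s <= t -> t <= b -> s = x \/ t = x -> t - s < d ->
       P s -> P t) ->
  P b.
Proof.
move=> ab Pa step.
pose S := [set t | a <= t <= b /\ P t].
have Sa : S a by rewrite /S/= lexx ab.
have ubS : ubound S b by move=> t [/andP[]].
have supS : has_sup S by split; [exists a|exists b].
pose m := sup S.
have am : a <= m by apply: ub_le_sup => //; exists b.
have mb : m <= b by apply: ge_sup => //; exists a.
have [d d0 stepm] := step m (introT andP (conj am mb)).
have [s [/andP[as_ sb] Ps] ms] := sup_adherent d0 supS.
have sm : s <= m by apply: ub_le_sup; [exists b|split => //; rewrite as_ sb].
have Pm : P m by apply: (stepm s m) => //; [right|rewrite -/m in ms; lra].
have [bm|mb'] := leP b m; first by rewrite (_ : b = m)//; apply/eqP; rewrite eq_le bm mb.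
pose t := Num.min (m + d / 2) b.
have [mt tb td] : [/\ m < t, t <= b & t - m < d].
  by rewrite /t; case: (leP (m + d / 2) b) => ?; split; lra.
have Pt : P t by apply: (stepm m t) => //; [exact: ltW|left].
have : t <= m by apply: ub_le_sup; [exists b|split => //; rewrite (le_trans am (ltW mt)) tb].
by rewrite leNgt mt.
Qed.

(** The difference quotients at [x] are eventually below [c]. They control only intervals having [x]
    as an endpoint, which is the form used by [segment_real_induction]. *)
Lemma derive1_le_local {R : realType} (g : R -> R) (x c : R) :
  derivable g x 1 -> derive1 g x < c ->
  exists2 d, 0 < d & forall s t, s <= t -> s = x \/ t = x -> t - s < d ->
    g t - g s <= c * (t - s).
Proof.
rewrite derive1E => dg; rewrite /derive => lc.
have /cvgr_lt/(_ _ lc) [d /= d0 H] := dg.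
exists d => // s t; rewrite le_eqVlt => /predU1P[->|st]; first by rewrite !subrr mulr0.
case=> [xE|xE] std.
- have := H (t - s); rewrite /= sub0r normrN gtr0_norm ?subr_gt0// subr_eq0.
  move=> /(_ std); rewrite gt_eqF// => /(_ isT).
  rewrite -xE /GRing.scale/= mulr1 subrK mulrC ltr_pdivrMr ?subr_gt0//.
  exact: ltW.
- have := H (s - t); rewrite /= sub0r normrN ltr0_norm ?subr_lt0// opprB subr_eq0.
  move=> /(_ std); rewrite lt_eqF// => /(_ isT).
  rewrite -xE /GRing.scale/= mulr1 subrK mulrC ltr_ndivrMr ?subr_lt0//.
  by move=> ?; nra.
Qed.

Lemma negligible_open_cover {R : realType} (E : set R) (d : R) : 0 < d ->
  (@lebesgue_measure R).-negligible E ->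
  exists U : set R, [/\ open U, E `<=` U & (@lebesgue_measure R U < d%:E)%E].
Proof.
move=> d0 [N [mN N0 EN]].
have [|U [oU NU Ud]] := lebesgue_regularity_outer mN _ d0.
  by rewrite [ltLHS]N0 ltry.
exists U; split => //; first exact: subset_trans NU.
apply: le_lt_trans Ud.
rewrite -[leRHS]add0e -[X in (X + _)%E]N0 addeC.
have mU : measurable U by exact: measurable_realfun.open_measurable.
rewrite -[leLHS](_ : lebesgue_measure ((U `\` N) `|` N) = _); last first.
  by rewrite setUC setDUK.
by apply: measureU2 => //; exact: measurableD.
Qed.

(** Disjoint intervals inside [U] have total length at most the measure of [U]. The families are
    indexed by [nat] and ordered from left to right, so that an interval can be appended at the
    end. *)
Lemma absolutely_continuous_open_sum {R : realType} (a b e : R) (g : R -> R) :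
  0 < e -> absolutely_continuous a b g ->
  exists2 d, 0 < d & forall (U : set R), open U ->
    (@lebesgue_measure R U < d%:E)%E ->
    forall n (u v : nat -> R),
      (forall i, (i < n)%N -> [/\ a <= u i, u i <= v i & v i <= b]) ->
      (forall i, (i < n)%N -> `]u i, v i[%classic `<=` U) ->
      (forall i j, (i < j < n)%N -> v i <= u j) ->
      \sum_(i < n) `|g (v i) - g (u i)| < e.
Proof.
move=> e0 acg; have [d d0 H] := acg e e0; exists d => // U oU Ud n u v uv uvU vu.
have tI : trivIset setT (fun i : 'I_n => `]u i, v i[%classic).
  apply/trivIsetP => i j _ _.
  wlog ij : i j / (i < j)%N.
    move=> W; rewrite neq_ltn => /orP[ij|ji]; first by apply: W; rewrite ?neq_ltn ?ij.
    by rewrite setIC; apply: W; rewrite ?neq_ltn ?ji.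
  move=> _; apply/seteqP; split => // x /=; rewrite !in_itv/= => -[/andP[_ xv] /andP[ux _]].
  have := vu i j; rewrite ij ltn_ord => /(_ isT) ?; lra.
apply: (H n u v) => //; first by move=> i; exact: uv.
rewrite -lte_fin; apply: le_lt_trans Ud.
have -> : (\sum_(i < n) (v i - u i))%:E =
    (@lebesgue_measure R (\big[setU/set0]_(i < n) `]u i, v i[%classic)).
  rewrite measure_bigsetU_ord// -sumEFin; apply: eq_bigr => i _.
  apply: (@etrans _ _ (@lebesgue_measure R `]u i, v i[%classic)) => //.
  rewrite lebesgue_measure_itv/= lte_fin.
  have [_ uvi _] := uv i (ltn_ord i).
  by case: ltgtP uvi => // -> _; rewrite subrr.
apply: le_measure; rewrite ?inE.
- by apply: bigsetU_measurable.
- exact: measurable_realfun.open_measurable.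
- by rewrite -(bigcup_mkord n (fun i => `]u i, v i[%classic)); apply: bigcup_sub => i /=; exact: uvU.
Qed.

Lemma absolutely_continuous_sub {R : realType} (a b a' b' : R) (g : R -> R) :
  a <= a' -> b' <= b -> absolutely_continuous a b g ->
  absolutely_continuous a' b' g.
Proof.
move=> aa bb acg e /acg[d d0 H]; exists d => // n u v uv; apply: H => i.
by have [? ? ?] := uv i; split => //; [exact: le_trans aa _|exact: le_trans bb].
Qed.

(* Real induction: a good point extends the bound with a slope slightly above c,
   while the bad null set is covered by an open set so small that absolute
   continuity makes the total increment of g over it negligible. *)
Lemma absolutely_continuous_increment_le {R : realType} (a b c : R) (g : R -> R) :
  0 <= c -> a <= b -> absolutely_continuous a b g ->
  {ae (@lebesgue_measure R), forall x, a < x < b ->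
     derivable g x 1 /\ derive1 g x <= c} ->
  g b - g a <= c * (b - a).
Proof.
move=> c0 ab acg gae.
apply/ler_addgt0Pr => e e0.
(* Over [[a, b]] the excess slope costs at most [e / 2]; the [+ 1] keeps the denominator positive
   when [a = b]. *)
pose c' := c + e / 2 / (b - a + 1).
have ba1 : 0 < b - a + 1 by lra.
have cc' : c < c' by rewrite /c' ltrDl !divr_gt0.
have c'ba : c' * (b - a) <= c * (b - a) + e / 2.
  rewrite /c' mulrDl lerD2l -[leRHS]mulr1 -!mulrA 2?ler_pM2l ?invr_gt0//.
  by rewrite mulrC ler_pdivrMr// mul1r lerDl.
have e20 : 0 < e / 2 by rewrite divr_gt0.
have [d d0 sumU] := absolutely_continuous_open_sum a b (e / 2) g e20 acg.
pose good x := a < x < b /\ derivable g x 1 /\ derive1 g x <= c.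
(* The endpoints count as bad points, since the hypothesis concerns the open interval only; they add
   two null singletons. *)
have bad0 : (@lebesgue_measure R).-negligible [set x | a <= x <= b /\ ~ good x].
  pose E := [set a] `|` [set b] `|` ~` [set x | a < x < b ->
     derivable g x 1 /\ derive1 g x <= c].
  suff : (@lebesgue_measure R).-negligible E.
    apply: negligibleS => x [/andP[ax xb] ngx]; have [xa|xa] := eqVneq x a; first by left; left.
    have [xb'|xb'] := eqVneq x b; first by left; right.
    right=> H; apply: ngx; split; last apply: H.
      by rewrite !lt_neqAle ax xb xb' eq_sym xa.
    by rewrite !lt_neqAle ax xb xb' eq_sym xa.
  apply: negligibleU => //; apply: negligibleU; apply/negligibleP => //;
  exact: lebesgue_measure_set1.
have [U [oU EU Ud]] := negligible_open_cover _ _ d0 bad0.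
(* The invariant of the induction: up to [t], the growth of [g] is paid for by the slope [c'] and by
   finitely many ordered intervals contained in [U]. *)
pose P t := exists n (u v : nat -> R),
  [/\ forall i, (i < n)%N -> [/\ a <= u i, u i <= v i & v i <= t],
      forall i, (i < n)%N -> `]u i, v i[%classic `<=` U,
      forall i j, (i < j < n)%N -> v i <= u j &
      g t - g a <= c' * (t - a) + \sum_(i < n) `|g (v i) - g (u i)|].
suff [n [u [v [uv uvU vu gba]]]] : P b.
  have := sumU U oU Ud n u v uv uvU vu; lra.
apply: (@segment_real_induction _ a) => //.
  exists 0%N, (fun=> 0), (fun=> 0); split => //.
  by rewrite !subrr mulr0 big_ord0 addr0.
have slopeP s t : s <= t -> g t - g s <= c' * (t - s) -> P s -> P t.
  move=> st gst [n [u [v [uv uvU vu gsa]]]]; exists n, u, v; split => //.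
    by move=> i /uv[? ? ?]; split => //; apply: le_trans st.
  move: gsa gst; rewrite !mulrBr; lra.
have openP s t : a <= s -> s <= t -> `]s, t[%classic `<=` U -> P s -> P t.
  move=> as_ st stU [n [u [v [uv uvU vu gsa]]]].
  exists n.+1, (fun i => if (i < n)%N then u i else s),
    (fun i => if (i < n)%N then v i else t); split => //.
  - move=> i _; have [iltn|//] := ltnP i n.
    by have [? ? vs] := uv i iltn; split => //; exact: le_trans st.
  - by move=> i _; have [/uvU|] := ltnP i n.
  - move=> i j /andP[ij]; rewrite ltnS leq_eqVlt => /predU1P[jn|jn].
      rewrite jn ltnn; rewrite jn in ij; rewrite ij.
      by have [] := uv i ij.
    by rewrite (ltn_trans ij jn) jn vu// ij.
  - rewrite big_ord_recr/= ltnn.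
    under eq_bigr do rewrite ltn_ord.
    have := ler_norm (g t - g s).
    have : 0 <= c' * (t - s) by rewrite mulr_ge0 ?subr_ge0// ltW// (le_lt_trans c0).
    move: gsa; rewrite !mulrBr; lra.
move=> x axb; have [gx|bx] := pselect (good x).
  have [_ [dx gxc]] := gx.
  have [d1 d10 H] := derive1_le_local g x c' dx (le_lt_trans gxc cc').
  exists d1 => // s t _ st _ sx ts; apply: slopeP => //; exact: H.
(* A bad point has a neighbourhood inside [U], so a short interval starting or ending there can be
   appended to the family. *)
have : U x by exact: EU.
rewrite openE in oU => /oU [d1/= d10 xU].
exists d1 => // s t as_ st tb sx ts; apply: openP => //.
move=> y; rewrite /= in_itv/= => /andP[sy yt]; apply: xU.
by rewrite /ball/= ltr_distlC; case: sx => <-; apply/andP; split; lra.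
Qed.

(** * Euclidean norm and corners of rectangles *)

Definition dotv {R : realType} (u v : 'cV[R]_2) : R := \sum_i u i 0 * v i 0.

Lemma dotv2E {R : realType} (u v : 'cV[R]_2) :
  dotv u v = u 0 0 * v 0 0 + u 1 0 * v 1 0.
Proof. by rewrite /dotv big_ord_recl big_ord1; congr (_ + u _ _ * v _ _); apply/val_inj. Qed.

Lemma enorm_ge0 {R : realType} (u : 'cV[R]_2) : 0 <= enorm u.
Proof. exact: sqrtr_ge0. Qed.

Lemma sqr_enorm {R : realType} (u : 'cV[R]_2) : enorm u ^+ 2 = dotv u u.
Proof. by rewrite sqr_sqrtr// sumr_ge0// => i _; rewrite sqr_ge0. Qed.

Lemma enormN {R : realType} (u : 'cV[R]_2) : enorm (- u) = enorm u.
Proof. by rewrite /enorm; congr Num.sqrt; apply: eq_bigr => i _; rewrite mxE sqrrN. Qed.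

Lemma enorm0 {R : realType} : enorm (0 : 'cV[R]_2) = 0.
Proof. by rewrite /enorm big1 ?sqrtr0// => i _; rewrite mxE expr0n. Qed.

Lemma dotv_le_enorm {R : realType} (u v : 'cV[R]_2) : dotv u v <= enorm u * enorm v.
Proof.
apply: le_trans (ler_norm _) _.
rewrite -(@ler_pXn2r _ 2) ?nnegrE ?mulr_ge0 ?enorm_ge0//.
rewrite real_normK ?num_real// exprMn !sqr_enorm !dotv2E.
(* By Lagrange's identity, this square is the defect in the Cauchy-Schwarz inequality. *)
by have := sqr_ge0 (u 0 0 * v 1 0 - u 1 0 * v 0 0); nra.
Qed.

Lemma enorm_le_dotv {R : realType} (u : 'cV[R]_2) (c : R) : 0 <= c ->
  dotv u u <= enorm u * c -> enorm u <= c.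
Proof.
move=> c0; rewrite -sqr_enorm expr2.
have := enorm_ge0 u; rewrite le_eqVlt => /predU1P[<-//|u0].
by rewrite ler_pM2l.
Qed.

Lemma dotvDr {R : realType} (e u v : 'cV[R]_2) : dotv e (u + v) = dotv e u + dotv e v.
Proof. by rewrite /dotv -big_split; apply: eq_bigr => i _; rewrite mxE mulrDr. Qed.

Lemma dotvZr {R : realType} (e u : 'cV[R]_2) (k : R) : dotv e (k *: u) = k * dotv e u.
Proof. by rewrite /dotv mulr_sumr; apply: eq_bigr => i _; rewrite mxE mulrCA. Qed.

Lemma dotv_sumr {R : realType} (I : finType) (e : 'cV[R]_2) (F : I -> 'cV[R]_2) :
  dotv e (\sum_i F i) = \sum_i dotv e (F i).
Proof.
rewrite /dotv exchange_big/=; apply: eq_bigr => i _.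
by rewrite summxE mulr_sumr.
Qed.

(** Pairing the sum [u] with itself gives an average of the numbers [dotv u (F i)], each at most
    [enorm u * c] by Cauchy-Schwarz. *)
Lemma enorm_convex_le {R : realType} (I : finType) (p : I -> R)
    (F : I -> 'cV[R]_2) (c : R) :
  (forall i, 0 <= p i) -> \sum_i p i = 1 -> (forall i, enorm (F i) <= c) ->
  enorm (\sum_i p i *: F i) <= c.
Proof.
move=> p0 p1 Fc.
(* Weights of sum 1 force [I] to be inhabited, so some norm lies below [c]. *)
have c0 : 0 <= c.
  case: (pickP I) => [i _|I0]; first exact: le_trans (enorm_ge0 _) (Fc i).
  by move: p1; rewrite big_pred0// => /eqP; rewrite eq_sym oner_eq0.
set u := \sum_i _; apply: enorm_le_dotv => //.
rewrite {2}/u dotv_sumr -[leRHS]mul1r -p1 mulr_suml; apply: ler_sum => i _.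
rewrite dotvZr ler_wpM2l//; apply: le_trans (dotv_le_enorm _ _) _.
by rewrite ler_wpM2l ?enorm_ge0.
Qed.

Lemma enormD_le {R : realType} (u v : 'cV[R]_2) : enorm (u + v) <= enorm u + enorm v.
Proof.
apply: enorm_le_dotv; first by rewrite addr_ge0 ?enorm_ge0.
by rewrite (dotvDr _ u v) mulrDr lerD// dotv_le_enorm.
Qed.

Lemma cornerE {R : realType} (X l : 'cV[R]_2) (psi : R) (j : 'I_4) :
  (corner X psi l j 0 0 = X 0 0 + (cos psi * ((-1) ^+ j * l 0 0)
     - sin psi * ((-1) ^+ j./2 * l 1 0))) *
  (corner X psi l j 1 0 = X 1 0 + (sin psi * ((-1) ^+ j * l 0 0)
     + cos psi * ((-1) ^+ j./2 * l 1 0))).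
Proof.
rewrite /corner /corner_sign; split; rewrite !mxE big_ord_recl big_ord1 !mul_diag_mx !mxE/=.
  by rewrite (_ : lift _ _ = 1) ?mulNr//; apply/val_inj.
by rewrite (_ : lift _ _ = 1)//; apply/val_inj.
Qed.

(* Bilinear interpolation weights of the corners for the point u of the box. *)
Definition box_weight {R : realType} (l u : 'cV[R]_2) (j : 'I_4) : R :=
  (1 + (-1) ^+ j * (u 0 0 / l 0 0)) / 2 * ((1 + (-1) ^+ j./2 * (u 1 0 / l 1 0)) / 2).

Lemma box_weight_ge0 {R : realType} (l u : 'cV[R]_2) j :
  (forall i, 0 < l i 0) -> (forall i, - l i 0 <= u i 0 <= l i 0) ->
  0 <= box_weight l u j.
Proof.
move=> l0 ul.
have H i : -1 <= u i 0 / l i 0 <= 1.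
  by rewrite ler_pdivlMr// ler_pdivrMr// mulN1r mul1r.
have K (k : nat) i : 0 <= (1 + (-1) ^+ k * (u i 0 / l i 0)) / 2.
  by have /andP[? ?] := H i; rewrite -signr_odd; case: odd; rewrite ?expr1 ?expr0; lra.
by rewrite mulr_ge0.
Qed.

Lemma sum_ord4 {V : nmodType} (F : 'I_4 -> V) :
  \sum_i F i = F (@Ordinal 4 0 isT) + F (@Ordinal 4 1 isT)
    + F (@Ordinal 4 2 isT) + F (@Ordinal 4 3 isT).
Proof.
rewrite !big_ord_recl big_ord0 addr0 !addrA.
by congr (F _ + F _ + F _ + F _); apply/val_inj.
Qed.

Lemma sum_box_weight {R : realType} (l u : 'cV[R]_2) : \sum_j box_weight l u j = 1.
Proof.
rewrite sum_ord4 /box_weight; move: (u 0 0 / _) (u 1 0 / _) => p q /=.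
by rewrite !(expr0, expr1, exprS); field.
Qed.

(** The weights sum to 1, which takes care of [X], and linearity of the rotation leaves an identity
    in the fixed box. The weights depend on neither [X] nor [psi], hence stay constant during the
    motion. *)
Lemma rectangle_point_corner {R : realType} (l u : 'cV[R]_2) (X : 'cV[R]_2) psi :
  (forall i, 0 < l i 0) ->
  X + Defs.rot psi *m u = \sum_j box_weight l u j *: corner X psi l j.
Proof.
move=> l0.
have -> : \sum_j box_weight l u j *: corner X psi l j =
    (\sum_j box_weight l u j) *: X +
    Defs.rot psi *m (\sum_j box_weight l u j *: (corner_sign R j *m l)).
  rewrite scaler_suml mulmx_sumr -big_split; apply: eq_bigr => j _ /=.
  by rewrite scalerDr scalemxAr.
rewrite sum_box_weight scale1r; congr (_ + _ *m _).
apply/colP => i; rewrite summxE.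
have E j : (box_weight l u j *: (corner_sign R j *m l)) i 0 = box_weight l u j *
    ((if i == 0 then (-1) ^+ j else (-1) ^+ j./2) * l i 0).
  by rewrite mxE mul_diag_mx !mxE.
under eq_bigr do rewrite E.
rewrite sum_ord4 /box_weight.
have l00 : l 0 0 != 0 by rewrite gt_eqF.
have l10 : l 1 0 != 0 by rewrite gt_eqF.
case: (eqVneq i 0) => [->|i0] /=; first by rewrite !(expr0, expr1, exprS); field; rewrite l00 l10.
have -> : i = 1 by move: i0; clear; case: i => -[|[|]]// ? _; apply/val_inj.
by rewrite !(expr0, expr1, exprS); field; rewrite l00 l10.
Qed.

(** * Motion of the corners *)

(** Common source of the closure properties below: sums, differences, multiples, sines and cosines
    all have increments dominated in this way. *)
Lemma absolutely_continuous_dominated {R : realType} (a b M : R) (f g h : R -> R) :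
  absolutely_continuous a b f -> absolutely_continuous a b g ->
  (forall s t, a <= s -> s <= t -> t <= b ->
     `|h t - h s| <= M * (`|f t - f s| + `|g t - g s|)) ->
  absolutely_continuous a b h.
Proof.
move=> acf acg hM e e0.
pose K := `|M| + 1.
have K0 : 0 < K by rewrite ltr_wpDl.
have e' : 0 < e / K / 2 by rewrite !divr_gt0.
have [df df0 Hf] := acf _ e'; have [dg dg0 Hg] := acg _ e'.
exists (Num.min df dg); first by rewrite lt_min df0 dg0.
move=> n u v uv tI; rewrite lt_min => /andP[/(Hf n u v uv tI) sf /(Hg n u v uv tI) sg].
apply: (@le_lt_trans _ _ (\sum_(i < n) K * (`|f (v i) - f (u i)| + `|g (v i) - g (u i)|))).
  apply: ler_sum => i _; have [? ? ?] := uv i; apply: le_trans (hM _ _ _ _ _) _ => //.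
  by rewrite ler_wpM2r ?addr_ge0// /K (le_trans (ler_norm M))// lerDl.
rewrite -mulr_sumr big_split/= mulrC -ltr_pdivlMr//; lra.
Qed.

Lemma absolutely_continuous_id {R : realType} (a b : R) :
  absolutely_continuous a b id.
Proof.
move=> e e0; exists e => // n u v uv _; apply: le_lt_trans.
by apply: ler_sum => i _; have [_ ? _] := uv i; rewrite ger0_norm// subr_ge0.
Qed.

Lemma absolutely_continuous_klipschitz {R : realType} (a b M : R) (h : R -> R) :
  (forall x y, a <= x <= b -> a <= y <= b -> `|h x - h y| <= M * `|x - y|) ->
  absolutely_continuous a b h.
Proof.
(* With both dominating functions equal to [id], the length is counted twice, hence [M / 2]. *)
move=> hM; apply: (@absolutely_continuous_dominated _ a b (M / 2) id id).
- exact: absolutely_continuous_id.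
- exact: absolutely_continuous_id.
- move=> s t as_ st tb; have := hM t s; rewrite as_ tb.
  rewrite (le_trans as_ st) (le_trans st tb) => /(_ isT isT) /=; lra.
Qed.

Lemma absolutely_continuousD {R : realType} (a b : R) (f g : R -> R) :
  absolutely_continuous a b f -> absolutely_continuous a b g ->
  absolutely_continuous a b (fun x => f x + g x).
Proof.
move=> acf acg; apply: (@absolutely_continuous_dominated _ a b 1 f g) => // s t _ _ _.
by rewrite mul1r (_ : _ - _ = (f t - f s) + (g t - g s)) ?ler_normD//; lra.
Qed.

Lemma absolutely_continuousZ {R : realType} (a b k : R) (f : R -> R) :
  absolutely_continuous a b f -> absolutely_continuous a b (fun x => k * f x).
Proof.
move=> acf; apply: (@absolutely_continuous_dominated _ a b `|k| f f) => // s t _ _ _.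
by rewrite -mulrBr normrM ler_wpM2l// lerDl.
Qed.

Lemma absolutely_continuousB {R : realType} (a b : R) (f g : R -> R) :
  absolutely_continuous a b f -> absolutely_continuous a b g ->
  absolutely_continuous a b (fun x => f x - g x).
Proof.
move=> acf acg; apply: (@absolutely_continuous_dominated _ a b 1 f g) => // s t _ _ _.
by rewrite mul1r (_ : _ - _ = (f t - f s) - (g t - g s)) ?ler_normB//; lra.
Qed.

Lemma cos_sin_dist_le {R : realType} (x y : R) :
  (`|cos x - cos y| <= `|x - y|) * (`|sin x - sin y| <= `|x - y|).
Proof.
wlog xy : x y / y <= x.
  move=> W; have [yx|/ltW xy] := leP y x; first exact: W.
  by rewrite (distrC x) (distrC (cos x)) (distrC (sin x)); exact: W.
split.
- have [c _ ->] : exists2 c, c \in `[y, x] & cos x - cos y = - sin c * (x - y).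
    apply: (@MVT_segment R cos (fun c => - sin c)) => //.
    by apply: continuous_subspaceT => c; exact: continuous_cos.
  by rewrite normrM normrN ler_piMl// ler_norml sin_geN1 sin_le1.
- have [c _ ->] : exists2 c, c \in `[y, x] & sin x - sin y = cos c * (x - y).
    apply: (@MVT_segment R sin cos) => //.
    by apply: continuous_subspaceT => c; exact: continuous_sin.
  by rewrite normrM ler_piMl// ler_norml cos_geN1 cos_le1.
Qed.

Lemma absolutely_continuous_cos {R : realType} (a b : R) (f : R -> R) :
  absolutely_continuous a b f -> absolutely_continuous a b (fun x => cos (f x)).
Proof.
move=> acf; apply: (@absolutely_continuous_dominated _ a b 1 f f) => // s t _ _ _.
by rewrite mul1r (le_trans (cos_sin_dist_le _ _).1)// lerDl.
Qed.

Lemma absolutely_continuous_sin {R : realType} (a b : R) (f : R -> R) :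
  absolutely_continuous a b f -> absolutely_continuous a b (fun x => sin (f x)).
Proof.
move=> acf; apply: (@absolutely_continuous_dominated _ a b 1 f f) => // s t _ _ _.
by rewrite mul1r (le_trans (cos_sin_dist_le _ _).2)// lerDl.
Qed.

Lemma ord2_ind (P : 'I_2 -> Prop) : P 0 -> P 1 -> forall i, P i.
Proof.
move=> P0 P1 [[|[|//]] i2]; first by rewrite (_ : Ordinal i2 = 0)//; apply/val_inj.
by rewrite (_ : Ordinal i2 = 1)//; apply/val_inj.
Qed.

Lemma corner_absolutely_continuous {R : realType} (a b : R)
    (X : R -> 'cV[R]_2) (psi : R -> R) (l : 'cV[R]_2) (j : 'I_4) :
  (forall i, absolutely_continuous a b (fun r => X r i 0)) ->
  absolutely_continuous a b psi ->
  forall i, absolutely_continuous a b (fun r => corner (X r) (psi r) l j i 0).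
Proof.
move=> acX acpsi; have accos := absolutely_continuous_cos a b psi acpsi.
have acsin := absolutely_continuous_sin a b psi acpsi.
move=> i; elim/ord2_ind: i.
- under eq_fun do rewrite cornerE ![_ * (_ * l _ _)]mulrC.
  refine (absolutely_continuousD _ _ _ _ (acX _) (absolutely_continuousB _ _ _ _
    (absolutely_continuousZ _ _ _ _ accos) (absolutely_continuousZ _ _ _ _ acsin))).
- under eq_fun do rewrite cornerE ![_ * (_ * l _ _)]mulrC.
  refine (absolutely_continuousD _ _ _ _ (acX _) (absolutely_continuousD _ _ _ _
    (absolutely_continuousZ _ _ _ _ acsin) (absolutely_continuousZ _ _ _ _ accos))).
Qed.

Lemma derivable_cos_comp {R : realType} (f : R -> R) (s : R) :
  derivable f s 1 -> derivable (fun r => cos (f r)) s 1.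
Proof.
move=> /derivable1_diffP df; apply/derivable1_diffP.
by apply: differentiable_comp => //; apply/derivable1_diffP; exact: derivable_cos.
Qed.

Lemma derivable_sin_comp {R : realType} (f : R -> R) (s : R) :
  derivable f s 1 -> derivable (fun r => sin (f r)) s 1.
Proof.
move=> /derivable1_diffP df; apply/derivable1_diffP.
by apply: differentiable_comp => //; apply/derivable1_diffP; exact: derivable_sin.
Qed.

Lemma corner_derivable {R : realType} (s : R) (X : R -> 'cV[R]_2) (psi : R -> R)
    (l : 'cV[R]_2) (j : 'I_4) :
  (forall i, derivable (fun r => X r i 0) s 1) -> derivable psi s 1 ->
  derivable (fun r => corner (X r) (psi r) l j) s 1.
Proof.
move=> dX dpsi; have dcos := derivable_cos_comp psi s dpsi.
have dsin := derivable_sin_comp psi s dpsi.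
have dcosM c : derivable (fun r => cos (psi r) * c) s 1.
  exact (derivableM dcos (derivable_cst c s 1)).
have dsinM c : derivable (fun r => sin (psi r) * c) s 1.
  exact (derivableM dsin (derivable_cst c s 1)).
apply/derivable_mxP => i j0; rewrite ord1; elim/ord2_ind: i.
- under eq_fun do rewrite cornerE.
  exact (derivableD (dX 0) (derivableB (dcosM _) (dsinM _))).
- under eq_fun do rewrite cornerE.
  exact (derivableD (dX 1) (derivableD (dsinM _) (dcosM _))).
Qed.

Lemma derive1_dotv {R : realType} (e : 'cV[R]_2) (D : R -> 'cV[R]_2) (s : R) :
  derivable D s 1 -> derivable (fun r => dotv e (D r)) s 1 /\
    derive1 (fun r => dotv e (D r)) s = dotv e (derive1 D s).
Proof.
move=> dD; have dDi i : derivable (fun r => D r i 0) s 1 by move/derivable_mxP : dD.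
have dZ i : derivable (fun r => e i 0 * D r i 0) s 1.
  exact (derivableM (derivable_cst (e i 0) s 1) (dDi i)).
under eq_fun do rewrite dotv2E.
split; first exact: derivableD.
rewrite !derive1E (derive_mx dD) dotv2E !mxE deriveD//.
by rewrite !(deriveZ (e _ 0))//.
Qed.

(** Projecting onto the fixed vector [e = D b - D a] reduces to the scalar case: [dotv e (D r)] has
    slope at most [enorm e * c] almost everywhere, and its increment is [enorm e ^+ 2]. *)
Lemma enorm_increment_le {R : realType} (a b c : R) (D : R -> 'cV[R]_2) :
  0 <= c -> a <= b -> (forall i, absolutely_continuous a b (fun r => D r i 0)) ->
  {ae (@lebesgue_measure R), forall x, a < x < b ->
     derivable D x 1 /\ enorm (derive1 D x) <= c} ->
  enorm (D b - D a) <= c * (b - a).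
Proof.
move=> c0 ab acD Dae.
have ba0 : 0 <= b - a by rewrite subr_ge0.
set e := D b - D a; apply: enorm_le_dotv; first by rewrite mulr_ge0.
have -> : dotv e e = dotv e (D b) - dotv e (D a).
  by rewrite {2}/e dotvDr -scaleN1r dotvZr mulN1r.
rewrite mulrA; apply: (@absolutely_continuous_increment_le _ a b _ (fun r => dotv e (D r))) => //.
- by rewrite mulr_ge0// enorm_ge0.
- under eq_fun do rewrite dotv2E.
  exact (absolutely_continuousD _ _ _ _
    (absolutely_continuousZ _ _ _ _ (acD 0)) (absolutely_continuousZ _ _ _ _ (acD 1))).
- apply: lebesgue_aeS Dae => x + axb => /(_ axb)[dD Dc].
  have [de ->] := derive1_dotv e D x dD; split => //.
  by apply: le_trans (dotv_le_enorm _ _) _; rewrite ler_wpM2l// enorm_ge0.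
Qed.

Lemma lipschitz_coord {R : realType} (T : R) (n : nat) (X : R -> 'cV[R]_n.+1) :
  [lipschitz X t | t in `[0, T]] -> exists M, forall i x y,
    0 <= x <= T -> 0 <= y <= T -> `|X x i 0 - X y i 0| <= M * `|x - y|.
Proof.
(* The Lipschitz property is stated for all constants near [+oo], that is strictly above some [M];
   [M + 1] is one of them. *)
move=> [M [_ H]]; exists (M + 1) => i x y xT yT.
have := H (M + 1) _ (x, y); rewrite ltrDl => /(_ ltr01) /=.
rewrite !in_itv/= => /(_ (conj xT yT)); apply: le_trans.
rewrite [leRHS]/Num.Def.normr/= mx_normrE.
by apply: le_trans (le_bigmax _ _ (i, 0)); rewrite !mxE.
Qed.

Lemma lipschitz_real {R : realType} (T : R) (f : R -> R) :
  [lipschitz f t | t in `[0, T]] -> exists M, forall x y,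
    0 <= x <= T -> 0 <= y <= T -> `|f x - f y| <= M * `|x - y|.
Proof.
move=> [M [_ H]]; exists (M + 1) => x y xT yT.
have := H (M + 1) _ (x, y); rewrite ltrDl => /(_ ltr01) /=.
by rewrite !in_itv/= => /(_ (conj xT yT)).
Qed.

(** * Signed distances *)

Lemma dist_to_ge0 {R : realType} (x : 'cV[R]_2) (B : set 'cV[R]_2) : 0 <= dist_to x B.
Proof.
have [->|/set0P[y By]] := eqVneq B set0; first by rewrite /dist_to image_set0 inf0.
apply: lb_le_inf; first by exists (enorm (x - y)), y.
by move=> _ [y' _ <-]; exact: enorm_ge0.
Qed.

(* An infimum that is not a genuine one takes the junk value 0, hence a positive
   lower bound on the signed distance is always meaningful. *)
Lemma set_signed_dist_gt {R : realType} (A B : set 'cV[R]_2) (e : R) x y :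
  0 <= e -> e < set_signed_dist A B -> A x -> B y -> e < enorm (x - y).
Proof.
move=> e0; rewrite lt_min => /andP[eAB _] Ax By.
have infAB : has_inf [set signed_dist B x | x in A].
  by apply: contrapT => /inf_out E; move: eAB; rewrite /min_signed_dist E ltNge e0.
have : e < signed_dist B x by apply: lt_le_trans eAB _; apply: ge_inf infAB.2 _ _; exists x.
rewrite /signed_dist; case: ifPn => _.
  by move=> e_lt; have := dist_to_ge0 x (~` B); lra.
move=> /lt_le_trans; apply; apply: ge_inf; last by exists y.
by exists 0 => _ [y' _ <-]; exact: enorm_ge0.
Qed.

(** Some [x] in [A] has signed distance below [e]. If it lies in [B], it is paired with itself;
    otherwise its distance to [B] is approximated by a point of [B]. *)
Lemma min_signed_dist_lt {R : realType} (A B : set 'cV[R]_2) (e : R) :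
  0 < e -> A !=set0 -> B !=set0 -> min_signed_dist A B < e ->
  exists x y, [/\ A x, B y & enorm (x - y) < e].
Proof.
move=> e0 [a Aa] [b Bb] /inf_lt [|_ [x Ax <-]]; first by exists (signed_dist B a), a.
rewrite /signed_dist; case: ifPn => [/set_mem Bx _|_].
  by exists x, x; split => //; rewrite subrr enorm0.
move=> /inf_lt [|_ [y By <-] xy]; first by exists (enorm (x - b)), b.
by exists x, y.
Qed.

Lemma set_signed_dist_lt {R : realType} (A B : set 'cV[R]_2) (e : R) :
  0 < e -> A !=set0 -> B !=set0 -> set_signed_dist A B < e ->
  exists x y, [/\ A x, B y & enorm (x - y) < e].
Proof.
move=> e0 A0 B0; rewrite gt_min => /orP[/min_signed_dist_lt|/min_signed_dist_lt].
  exact.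
move=> /(_ e0 B0 A0)[y [x [By Ax yx]]]; exists x, y; split => //.
by rewrite -enormN opprB.
Qed.

Lemma rectangle_center {R : realType} (X : 'cV[R]_2) psi (l : 'cV[R]_2) :
  (forall i, 0 < l i 0) -> rectangle X psi l X.
Proof.
move=> l0; exists 0; last by rewrite mulmx0 addr0.
by move=> i; rewrite mxE oppr_le0 ltW// l0.
Qed.

(** * Gaps between moving points of the vehicle and of an obstacle *)

(** Product weights bring two independent averages to a common index set, so that a gap between
    points becomes an average of corner gaps. *)
Lemma convex_combination_sub {R : realType} (I J : finType) (p : I -> R)
    (q : J -> R) (F : I -> 'cV[R]_2) (G : J -> 'cV[R]_2) :
  \sum_i p i = 1 -> \sum_j q j = 1 ->
  \sum_i p i *: F i - \sum_j q j *: G j =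
  \sum_(k : I * J) (p k.1 * q k.2) *: (F k.1 - G k.2).
Proof.
move=> p1 q1; rewrite -(pair_big xpredT xpredT (fun i j => (p i * q j) *: (F i - G j)))/=.
have -> : \sum_i p i *: F i = \sum_i \sum_j (p i * q j) *: F i.
  by apply: eq_bigr => i _; rewrite -scaler_suml -mulr_sumr q1 mulr1.
have -> : \sum_j q j *: G j = \sum_i \sum_j (p i * q j) *: G j.
  rewrite exchange_big/=; apply: eq_bigr => j _.
  by rewrite -scaler_suml -mulr_suml p1 mul1r.
rewrite -sumrB; apply: eq_bigr => i _; rewrite -sumrB.
by apply: eq_bigr => j _; rewrite scalerBr.
Qed.

Section CornerMotion.
Context {R : realType} (T amin amax wmax : R) (l : 'cV[R]_2).
Context (z : R -> state R) (w a : R -> R) (k : nat).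
Context (lo : 'I_k -> 'cV[R]_2) (Xo : 'I_k -> R -> 'cV[R]_2).
Context (psio : 'I_k -> R -> R) (vbar : R).
Context (z_traj : point_mass_trajectory T amin amax wmax z w a).
Context (Xo_lip : forall i, [lipschitz Xo i t | t in `[0, T]]).
Context (psio_lip : forall i, [lipschitz psio i t | t in `[0, T]]).
Context (vbar_bound : relative_velocity_bound lo Xo psio T l z vbar).
Context (vbar_ge0 : 0 <= vbar).

Let gap i j j' r := vehicle_corner l (z r) j - obstacle_corner lo Xo psio i j' r.

Lemma corner_gap_increment_le i j j' s t : 0 <= s -> s <= t -> t <= T ->
  enorm (gap i j j' t - gap i j j' s) <= vbar * (t - s).
Proof.
move=> s0 st tT.
have [MX XM] := lipschitz_coord T 1 (Xo i) (Xo_lip i).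
have [Mp pM] := lipschitz_real T (psio i) (psio_lip i).
apply: enorm_increment_le => //.
- move=> c; apply: (absolutely_continuous_sub 0 T) => //.
  have -> : (fun r => gap i j j' r c 0) =
      (fun r => vehicle_corner l (z r) j c 0 - obstacle_corner lo Xo psio i j' r c 0).
    by apply/funext => r; rewrite [LHS]mxE [X in _ + X]mxE.
  refine (absolutely_continuousB _ _ _ _ _ _).
    apply: (corner_absolutely_continuous 0 T (fun r => position (z r))).
      elim/ord2_ind; under eq_fun do rewrite mxE/=.
        exact: traj_ac_x z_traj.
      exact: traj_ac_y z_traj.
    exact: traj_ac_psi z_traj.
  apply: corner_absolutely_continuous.
    by move=> c'; apply: absolutely_continuous_klipschitz (XM c').
  exact: absolutely_continuous_klipschitz pM.
- have Xae c := klipschitz_ae_derivable 0 T MX (fun r => Xo i r c 0) (XM c).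
  have pae := klipschitz_ae_derivable 0 T Mp (psio i) pM.
  have zae := traj_ode z_traj.
  (* At almost every time all corners are derivable, so that [derive1] of the gap splits into the
     difference bounded by [vbar]. *)
  have := lebesgue_aeI _ _ (lebesgue_aeI _ _ (Xae 0) (Xae 1))
    (lebesgue_aeI _ _ pae (lebesgue_aeI _ _ zae vbar_bound)).
  apply: lebesgue_aeS => x [[X0 X1] [p [zx vx]]] /andP[sx xt].
  have x0T : 0 < x < T by rewrite (le_lt_trans s0 sx) (lt_le_trans xt tT).
  have x0T' : 0 <= x <= T by have /andP[? ?] := x0T; rewrite !ltW.
  have [dx dy dpsi _] := zx x0T'.
  have dv : derivable (fun r => vehicle_corner l (z r) j) x 1.
    apply: (corner_derivable x (fun r => position (z r))); last exact: ex_derive.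
    by elim/ord2_ind; under eq_fun do rewrite mxE/=; exact: ex_derive.
  have do_ : derivable (obstacle_corner lo Xo psio i j') x 1.
    apply: corner_derivable; last exact: p.
    by elim/ord2_ind; [exact: X0|exact: X1].
  split; first exact: derivableB.
  have -> : derive1 (gap i j j') x = derive1 (fun r => vehicle_corner l (z r) j) x
      - derive1 (obstacle_corner lo Xo psio i j') x.
    by rewrite 3!derive1E; exact (deriveB dv do_).
  exact (vx x0T' i j j').
Qed.

(** [u] and [u'] are coordinates in the moving frames: the same two material points are followed as
    [r] varies. *)
Definition body_gap i (u u' : 'cV[R]_2) r :=
  position (z r) + Defs.rot (heading (z r)) *m u
  - (Xo i r + Defs.rot (psio i r) *m u').

Lemma body_gap_increment_le i (u u' : 'cV[R]_2) s t :
  (forall c, 0 < l c 0) -> (forall c, 0 < lo i c 0) ->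
  (forall c, - l c 0 <= u c 0 <= l c 0) ->
  (forall c, - lo i c 0 <= u' c 0 <= lo i c 0) ->
  0 <= s <= T -> 0 <= t <= T ->
  enorm (body_gap i u u' t - body_gap i u u' s) <= vbar * `|t - s|.
Proof.
move=> l0 lo0 ul ul' sT tT; pose bgap := body_gap i u u'; rewrite -/bgap.
have bgapE r : bgap r = \sum_(q : 'I_4 * 'I_4)
    (box_weight l u q.1 * box_weight (lo i) u' q.2) *: gap i q.1 q.2 r.
  rewrite /bgap /body_gap (rectangle_point_corner l)// (rectangle_point_corner (lo i))//.
  by rewrite convex_combination_sub ?sum_box_weight.
have mono r1 r2 : 0 <= r1 -> r1 <= r2 -> r2 <= T ->
    enorm (bgap r2 - bgap r1) <= vbar * (r2 - r1).
  move=> r10 r12 r2T.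
  rewrite !bgapE -sumrB; under eq_bigr do rewrite -scalerBr.
  apply: enorm_convex_le.
  - by move=> q; rewrite mulr_ge0 ?box_weight_ge0.
  - rewrite -(pair_big xpredT xpredT
      (fun j j' => box_weight l u j * box_weight (lo i) u' j'))/=.
    under eq_bigr do rewrite -mulr_sumr sum_box_weight mulr1.
    exact: sum_box_weight.
  - by move=> q; exact: corner_gap_increment_le.
have [/andP[s0 sT'] /andP[t0 tT']] := (sT, tT).
have [st|/ltW ts] := leP s t.
  by rewrite ger0_norm ?subr_ge0//; exact: mono.
rewrite -enormN opprB distrC ger0_norm ?subr_ge0//; exact: mono.
Qed.

End CornerMotion.

(* The division is the one of extended reals, for which eps / 0 = +oo. *)
Theorem mainTheorem6 (R : realType) (T amin amax wmax : R) (l : 'cV[R]_2)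
    (z : R -> state R) (w a : R -> R)
    (k : nat) (lo : 'I_k -> 'cV[R]_2) (Xo : 'I_k -> R -> 'cV[R]_2)
    (psio : 'I_k -> R -> R) (vbar eps tn tn1 : R)
    (T_gt0 : 0 < T)
    (l_gt0 : forall c, 0 < l c 0)
    (z_traj : point_mass_trajectory T amin amax wmax z w a)
    (k_ge1 : (1 <= k)%N)
    (lo_gt0 : forall i c, 0 < lo i c 0)
    (Xo_lip : forall i, [lipschitz Xo i t | t in `[0, T]])
    (psio_lip : forall i, [lipschitz psio i t | t in `[0, T]])
    (vbar_bound : relative_velocity_bound lo Xo psio T l z vbar)
    (eps_gt0 : 0 < eps)
    (tn_ge0 : 0 <= tn) (tn_lt : tn < tn1) (tn1_le : tn1 <= T)
    (d_gt_eps : Num.min (vehicle_obstacles_dist lo Xo psio l z tn)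
                        (vehicle_obstacles_dist lo Xo psio l z tn1) > eps) :
  (((tn1 - tn) / 2)%:E < eps%:E / vbar%:E)%E ->
  forall t : R, tn <= t <= tn1 -> 0 < vehicle_obstacles_dist lo Xo psio l z t.
Proof.
move=> dt t /andP[tnt ttn1].
(* A negative [vbar] would make the quotient negative, below the positive half step; for [vbar = 0]
   the product vanishes. *)
have [vbar_ge0 dtv] : 0 <= vbar /\ vbar * ((tn1 - tn) / 2) < eps.
  move: dt; rewrite inver; have [->|v0] := eqVneq vbar 0; first by rewrite mul0r.
  rewrite -EFinM lte_fin; have [vneg|vge0] := ltP vbar 0 => dt.
    have : eps / vbar < 0 by rewrite pmulr_rlt0// invr_lt0.
    lra.
  have vpos : 0 < vbar by rewrite lt_neqAle eq_sym v0.
  by split => //; rewrite mulrC -ltr_pdivlMr.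
move: d_gt_eps; rewrite lt_min => /andP[dn dn1].
(* [t'] is the endpoint nearest to [t], hence at most half a step away. *)
have [t' [t'T tt' dt']] : exists t', [/\ 0 <= t' <= T,
    `|t' - t| <= (tn1 - tn) / 2 & eps < vehicle_obstacles_dist lo Xo psio l z t'].
  have [tl|tr] := leP (t - tn) ((tn1 - tn) / 2).
    exists tn; split => //; first by apply/andP; split; lra.
    by rewrite distrC ger0_norm// subr_ge0.
  by exists tn1; split => //; [apply/andP; split; lra|rewrite ger0_norm; lra].
pose i0 := Ordinal k_ge1.
rewrite ltNge; apply/negP => d0.
(* The slack left by the motion: points closer than [delta] at time [t] are still closer than [eps]
   at time [t']. *)
pose delta := eps - vbar * ((tn1 - tn) / 2).
have delta0 : 0 < delta by rewrite subr_gt0.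
have [] := set_signed_dist_lt _ _ delta delta0 _ _ (le_lt_trans d0 delta0).
- by exists (position (z t)); exact: rectangle_center.
- by exists (Xo i0 t), i0 => //; exact: rectangle_center.
move=> _ [_ [[u ul <-] [i _ [u' ul' <-]] close]].
have tT : 0 <= t <= T by apply/andP; split; lra.
have := set_signed_dist_gt _ _ eps
  (position (z t') + Defs.rot (heading (z t')) *m u)
  (Xo i t' + Defs.rot (psio i t') *m u') (ltW eps_gt0) dt'.
move=> /(_ (ex_intro2 _ _ u ul erefl)).
move=> /(_ (ex_intro2 _ _ i I (ex_intro2 _ _ u' ul' erefl))).
apply/negP; rewrite -leNgt.
have := body_gap_increment_le T amin amax wmax l z w a k lo Xo psio vbar
  z_traj Xo_lip psio_lip vbar_bound vbar_ge0 i u u' t t' l_gt0 (lo_gt0 i) ul ul' tT t'T.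
rewrite -[X in enorm X <= eps]/(body_gap z k Xo psio i u u' t').
rewrite -[X in enorm X < _]/(body_gap z k Xo psio i u u' t) in close.
move: (body_gap _ _ _ _ _ _ _ t') (body_gap _ _ _ _ _ _ _ t) close => g' g close motion.
(* Triangle inequality for [g' = g + (g' - g)]: less than [delta] for [g], at most [eps - delta] for
   the motion. *)
rewrite -(subrK g g') addrC.
apply: le_trans (enormD_le _ _) _.
have : vbar * `|t' - t| <= vbar * ((tn1 - tn) / 2) by rewrite ler_wpM2l.
rewrite /delta in close; lra.
Qed.
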